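(* (i) The operator $\mathfrak{D} = q \frac{d}{dq}$ is a derivation on $\mathcal{MD}_N$. (ii) Let $d\ge 2$, $\mathbf{s}=(s_1,\dots,s_d)\in\mathbb{N}^d$ and $\boldsymbol{\alpha}=(\alpha_1,\dots,\alpha_d)\in(\mathbb{Z}/N\mathbb{Z})^d$. For any $j\le d$ let $\mathbf{e}_j=(0,\dots,1,\dots,0)\in \mathbb{Z}^d$ be the $j$-th standard unit vector and put $\boldsymbol{\alpha}(j)=(\alpha_1,\dots,\alpha_j,\alpha_j,\dots,\alpha_d)$ with only $\alpha_j$ repeated once. Then \begin{align*} \mathfrak{D}[\mathbf{s};\boldsymbol{\alpha}]=&[2;0]\cdot [\mathbf{s};\boldsymbol{\alpha}] +\sum_{j=1}^d (d-j+1) s_j[\mathbf{s}+\mathbf{e}_j;\boldsymbol{\alpha}] -\sum_{j=1}^d s_j[\mathbf{s}+\mathbf{e}_j,1;\boldsymbol{\alpha},0] \\ -&\, [\mathbf{s},2;\boldsymbol{\alpha},0]-\sum_{j=1}^d \sum_{a+b=s_j+2} (a-1) [s_1,\dots,s_{j-1},a,b,s_{j+1},\dots,s_d;\boldsymbol{\alpha}(j)] \\ -&\, \sum_{j=1}^d \sum_{\ell=1}^{j-1} \sum_{a+b=s_j+1} s_\ell [s_1+\delta_{\ell,1},\dots,s_{j-1}+\delta_{\ell,j-1},a,b,s_{j+1},\dots,s_d;\boldsymbol{\alpha}(j)]. \end{align*} Hence $\mathfrak{D}$ maps $\operatorname{Fil}^{W,L;N}_{k,d}(\mathcal{MD}_N)$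 into $\operatorname{Fil}^{W,L;N}_{k+2,d+1}(\mathcal{MD}_N)$.
   Context: Fix $N\ge1$, $\eta=\exp(2\pi\sqrt{-1}/N)$ and $\mathbb{Q}_N=\mathbb{Q}(\eta)$. For $\mathbf{s}=(s_1,\dots,s_d)\in\mathbb{N}^d$ and $\boldsymbol{\alpha}=(\alpha_1,\dots,\alpha_d)\in(\mathbb{Z}/N\mathbb{Z})^d$ the multiple divisor function (MDF) at level $N$ is the $q$-series $[\mathbf{s};\boldsymbol{\alpha}] = \frac{1}{(s_1-1)!\cdots(s_d-1)!}\sum_{n>0}\Big(\sum_{u_1v_1+\cdots+u_dv_d=n,\ u_1>\dots>u_d>0}\eta^{\alpha_1v_1+\cdots+\alpha_dv_d}v_1^{s_1-1}\cdots v_d^{s_d-1}\Big)q^n\in\mathbb{Q}_N[\![q]\!]$, of weight $s_1+\dots+s_d$ and depth $d$; colors $\alpha_j$ are read modulo $N$. $\mathcal{MD}_N$ is the $\mathbb{Q}_N$-vector space spanned by $1$ and all MDFs (an algebra under multiplication of power series), and $\operatorname{Fil}^{W,L;N}_{k,d}(\mathcal{MD}_N)$ denotes the span of MDFs of weight $\le k$ and depth $\le d$. Sums $\sum_{a+b=m}$ run over $a,b\in\mathbb{N}$. *)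

(* Defs.v *)
From HB Require Import structures.
From mathcomp Require Import all_boot all_order all_algebra.
From mathcomp Require Import complex.
From mathcomp Require Import all_classical all_reals all_analysis.

Set Implicit Arguments.
Unset Strict Implicit.
Unset Printing Implicit Defensive.

Import Order.TTheory GRing.Theory Num.Theory.

Local Open Scope classical_set_scope.
Local Open Scope ring_scope.

(* Formal power series in q over the complex numbers, as their sequences of
   coefficients.  Sums and scalar multiples are the pointwise ones on
   functions; the pointwise product on functions is NOT the product of power
   series, which is [qmul]. *)
Notation qseries R := (nat -> R[i]) (only parsing).

Definition qone (R : realType) : qseries R := fun n => (n == 0%N)%:R.

Definition qmul (R : realType) (f g : qseries R) : qseries R :=
  fun n => \sum_(i < n.+1) f i * g (n - i)%N.

(* q d/dq *)
Definition qD (R : realType) (f : qseries R) : qseries R :=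
  fun n => n%:R * f n.

(* exp (2 pi sqrt(-1) / N), by Euler's formula *)
Definition eta (R : realType) (N : nat) : R[i] :=
  Complex (cos (2 * pi / N%:R)) (sin (2 * pi / N%:R)).

(* Q(eta): the smallest subfield of the complex numbers containing eta *)
Definition QN (R : realType) (N : nat) : set R[i] :=
  [set x | forall K : {pred R[i]}, divring_closed K -> eta R N \in K -> x \in K].

Arguments QN : clear implicits.

Definition QN_span (R : realType) (N : nat) (G : set (qseries R)) :
    set (qseries R) :=
  [set f | exists (r : nat) (c : 'I_r -> R[i]) (g : 'I_r -> qseries R),
      [/\ forall i, QN R N (c i), forall i, G (g i) &
          f = \sum_(i < r) c i *: g i]].

(* The level is N = m.+1 >= 1, and Z/NZ is 'I_m.+1 with its canonical zmodType
   structure (this includes N = 1, for which 'Z_N would be Z/2Z). *)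

(* The multiple divisor function [s; al]; it is meant for size s = size al and
   positive entries of s.  In the coefficient of q^n all the u_i and v_i are at
   most n, so they range over 'I_n.+1. *)
Definition mdf (R : realType) (m : nat) (s : seq nat) (al : seq 'I_m.+1) :
    qseries R :=
  fun n => if n is 0%N then 0 else
    (\prod_(i < size s) ((nth 0%N s i).-1)`!%:R)^-1 *
    \sum_(u : {ffun 'I_(size s) -> 'I_n.+1})
    \sum_(v : {ffun 'I_(size s) -> 'I_n.+1} |
        [&& [forall i, (0 < u i)%N && (0 < v i)%N],
            [forall i : 'I_(size s), forall j : 'I_(size s),
               (i < j)%N ==> (u j < u i)%N] &
            (\sum_(i < size s) (u i * v i) == n)%N])
      \prod_(i < size s) (eta R m.+1 ^+ (nth (0%R : 'I_m.+1) al i * v i)%N *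
                           (v i)%:R ^+ (nth 0%N s i).-1).

Definition is_mdf (R : realType) (m : nat) (s : seq nat) (al : seq 'I_m.+1)
    (f : qseries R) : Prop :=
  [/\ (0 < size s)%N, size al = size s, all (fun k => 0 < k)%N s &
      f = mdf R s al].

Definition MD (R : realType) (m : nat) : set (qseries R) :=
  QN_span m.+1 [set f | f = qone R \/
                        exists s (al : seq 'I_m.+1), is_mdf s al f].

Definition Fil (R : realType) (m k d : nat) : set (qseries R) :=
  QN_span m.+1 [set f | exists s (al : seq 'I_m.+1),
                        [/\ is_mdf s al f, (sumn s <= k)%N & (size s <= d)%N]].

Arguments MD : clear implicits.
Arguments Fil : clear implicits.

(* D restricts to a K-linear derivation of A *)
Definition is_derivation_on (R : realType) (K : set R[i]) (A : set (qseries R))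
    (D : qseries R -> qseries R) : Prop :=
  [/\ forall f, A f -> A (D f),
      forall c f g, K c -> A f -> A g -> D (c *: f + g) = c *: D f + D g &
      forall f g, A f -> A g -> D (qmul f g) = qmul (D f) g + qmul f (D g)].

(* Main.v *)
Require Import Defs.
From HB Require Import structures.
From mathcomp Require Import all_boot all_order all_algebra.
From mathcomp Require Import complex.
From mathcomp Require Import all_classical all_reals all_analysis.
From mathcomp Require Import zify ring.

Set Implicit Arguments.
Unset Strict Implicit.
Unset Printing Implicit Defensive.

Import Order.TTheory GRing.Theory Num.Theory.

Local Open Scope classical_set_scope.
Local Open Scope ring_scope.

(* Write e(V) = q^V / (1 - q^V).  Conjugating partitions, i.e. putting
   V_i = v_1 + ... + v_i and k_i = u_i - u_(i+1), turns the sum over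
   u_1 > ... > u_d of q^(sum u_i v_i) into prod_i e(V_i).  Since
   D e(V) = V e(V) (1 + e(V)), D multiplies this product by
   sum_i V_i + sum_i V_i e(V_i).  The first sum gives the terms s + e_j; the
   second one is [2;0] = sum_W W e(W) minus the sum over all W different from
   the V_i, and inserting such a W either after V_d or between V_(j-1) and V_j
   gives the remaining terms.

   For the filtration, [2;0] * [s;al] is expanded by the quasi-shuffle product
   in u_1 > ... > u_d.  When the new u equals some u_j the letters v and
   eta^(al v) v^(s-1) are convolved, and the result is a combination of letters
   of weight at most s + 2 because power sums of eta^(al v) v^k over v < w are
   combinations of eta^(al w) w^j and 1. *)

(** * Truncated power series *)

Section Truncation.
Variables (C : comNzRingType) (K : nat).
Implicit Types (p q : {poly C}).

(** Congruence modulo ['X^K]. Series identities are proved at this truncated level; the coefficient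
    of q^n is then read with [K = n.+1]. *)
Definition eqm p q := forall i, (i < K)%N -> p`_i = q`_i.

Definition theta p : {poly C} := 'X * p^`().

Lemma eq_eqm p q : p = q -> eqm p q. Proof. by move->. Qed.

Lemma eqm_sym p q : eqm p q -> eqm q p.
Proof. by move=> h i hi; rewrite h. Qed.

Lemma eqm_trans q p r : eqm p q -> eqm q r -> eqm p r.
Proof. by move=> h1 h2 i hi; rewrite h1 // h2. Qed.

Lemma eqmD p p' q q' : eqm p p' -> eqm q q' -> eqm (p + q) (p' + q').
Proof. by move=> h1 h2 i hi; rewrite !coefD h1 // h2. Qed.

Lemma eqmB p p' q q' : eqm p p' -> eqm q q' -> eqm (p - q) (p' - q').
Proof. by move=> h1 h2 i hi; rewrite !coefB h1 // h2. Qed.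

Lemma eqmZ c p p' : eqm p p' -> eqm (c *: p) (c *: p').
Proof. by move=> h1 i hi; rewrite !coefZ h1. Qed.

Lemma eqmM p p' q q' : eqm p p' -> eqm q q' -> eqm (p * q) (p' * q').
Proof.
move=> h1 h2 i hi; rewrite !coefM; apply: eq_bigr => j _.
by rewrite h1 ?h2 // (leq_ltn_trans _ hi) ?leq_subr // -ltnS.
Qed.

Lemma eqm_sum (I : Type) (r : seq I) (P : pred I) (F G : I -> {poly C}) :
  (forall i, P i -> eqm (F i) (G i)) ->
  eqm (\sum_(i <- r | P i) F i) (\sum_(i <- r | P i) G i).
Proof.
move=> h j hj; rewrite !coef_sum; apply: eq_bigr => i Pi; exact: h.
Qed.

Lemma coef_theta p i : (theta p)`_i = p`_i *+ i.
Proof. by rewrite /theta coefXM coef_deriv; case: i => [|i] //=; rewrite mulr0n. Qed.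

Lemma thetaD p q : theta (p + q) = theta p + theta q.
Proof. by rewrite /theta derivD mulrDr. Qed.

Lemma thetaZ c p : theta (c *: p) = c *: theta p.
Proof. by rewrite /theta derivZ scalerAr. Qed.

Lemma thetaM p q : theta (p * q) = theta p * q + p * theta q.
Proof. by rewrite /theta derivM; ring. Qed.

Lemma theta_sum (I : Type) (r : seq I) (P : pred I) (F : I -> {poly C}) :
  theta (\sum_(i <- r | P i) F i) = \sum_(i <- r | P i) theta (F i).
Proof. by rewrite /theta linear_sum mulr_sumr. Qed.

Lemma thetaXn n : theta ('X^n) = n%:R *: 'X^n.
Proof.
by apply/polyP => i; rewrite coef_theta coefZ coefXn; case: eqP => [->|_];
  rewrite ?mulr1 ?mulr0 ?mul0rn.
Qed.

Lemma eqm_theta p q : eqm p q -> eqm (theta p) (theta q).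
Proof. by move=> h i hi; rewrite !coef_theta h. Qed.

Lemma eqm_Xn0 n : (K <= n)%N -> eqm 'X^n 0.
Proof.
by move=> h i hi; rewrite coefXn coef0 ltn_eqF // (leq_trans hi).
Qed.

Lemma eqmM0 p q : eqm p 0 -> eqm (p * q) 0.
Proof. by move=> h; rewrite -(mul0r q); apply: eqmM. Qed.

Lemma eqm_sum0 (I : Type) (r : seq I) (P : pred I) (F : I -> {poly C}) :
  (forall i, P i -> eqm (F i) 0) -> eqm (\sum_(i <- r | P i) F i) 0.
Proof.
move=> h j hj; rewrite coef_sum coef0 big1 // => i Pi.
by rewrite h // coef0.
Qed.

Lemma eqm_sum_trunc (L M : nat) (P : pred nat) (F : nat -> {poly C}) :
  (forall i, (M <= i)%N -> eqm (F i) 0) -> (M <= L)%N ->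
  eqm (\sum_(0 <= i < L | P i) F i) (\sum_(0 <= i < M | P i) F i).
Proof.
move=> h ML; rewrite (big_cat_nat (n:=M)) //= -[X in eqm _ X]addr0.
apply: eqmD => //; rewrite big_nat_cond; apply: eqm_sum0 => i.
by case/andP=> /andP[Mi _] _; apply: h.
Qed.

(** Reindexing overshoots the range by [a], and the terms from [K] on vanish modulo ['X^K]. *)
Lemma eqm_shift (a : nat) (F : nat -> {poly C}) :
  (forall i, (K <= i)%N -> eqm (F i) 0) ->
  eqm (\sum_(0 <= k < K | (0 < k)%N) F (a + k)%N)
      (\sum_(0 <= i < K | (a < i)%N) F i).
Proof.
move=> h; have -> : \sum_(0 <= k < K | (0 < k)%N) F (a + k)%N =
    \sum_(0 <= i < K + a | (a < i)%N) F i.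
  rewrite [RHS](big_cat_nat (n:=a)) ?leq_addl //=.
  have -> : \sum_(0 <= i < a | (a < i)%N) F i = 0.
    by rewrite big_nat_cond big1 // => i; lia.
  rewrite add0r -{2}[a]add0n big_addn addnK.
  apply: eq_big => [i|i _]; last by rewrite addnC.
  by lia.
by apply: eqm_sum_trunc => //; rewrite leq_addr.
Qed.

(** For V > 0, the truncation of q^V / (1 - q^V); locked so that simplification leaves it alone. *)
Definition geom (V : nat) : {poly C} :=
  locked (\sum_(0 <= k < K | (0 < k)%N) 'X^(k * V)).

Lemma geom_sumE V : geom V = \sum_(0 <= k < K | (0 < k)%N) 'X^(k * V).
Proof. by rewrite /geom -lock. Qed.

Lemma geom0 V : (K <= V)%N -> eqm (geom V) 0.
Proof.
move=> h; rewrite geom_sumE; apply: eqm_sum0 => k k0; apply: eqm_Xn0.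
by rewrite (leq_trans h) // leq_pmull.
Qed.

Lemma geom_shift u V : (0 < V)%N ->
  eqm (\sum_(0 <= k < K | (u < k)%N) 'X^(k * V)) ('X^(u * V) * geom V).
Proof.
move=> V0; apply: eqm_sym; rewrite geom_sumE mulr_sumr.
under eq_bigr => k _ do rewrite -exprD -mulnDl.
apply: (@eqm_shift u (fun k => 'X^(k * V))) => i Ki.
by apply: eqm_Xn0; rewrite (leq_trans Ki) // leq_pmulr.
Qed.

Lemma geomE V : (0 < V)%N -> eqm (geom V) ('X^V + 'X^V * geom V).
Proof.
move=> V0.
apply: (@eqm_trans ('X^V + \sum_(0 <= k < K | (1 < k)%N) 'X^(k * V))); last first.
  by apply: eqmD => //; have := @geom_shift 1 V V0; rewrite mul1n.
(* For [K <= 1] the range contains no positive index, and both sides vanish modulo ['X^K]. *)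
case: (ltnP 1 K) => K1; last first.
  apply: (@eqm_trans 0).
    rewrite geom_sumE big_nat_cond; apply: eqm_sum0 => i /andP[/andP[_ h1] h2].
    by have := leq_trans h1 K1; rewrite ltnNge h2.
  rewrite big_nat_cond big1 ?addr0; last first.
    move=> i /andP[/andP[_ h1] h2].
    by have := leq_trans h1 K1; rewrite ltnNge (ltnW h2).
  by apply/eqm_sym/eqm_Xn0; rewrite (leq_trans K1).
rewrite !geom_sumE !(big_ltn_cond (m:=0)) ?(ltnW K1) //= !(big_ltn_cond (m:=1)) //= mul1n.
apply: eqmD => //; rewrite big_nat_cond [X in eqm _ X]big_nat_cond.
rewrite (eq_bigl (fun i => (1 < i < K)%N && (1 < i)%N)) // => i.
by case: i => [|[|i]].
Qed.

(* Both sides agree after multiplication by [1 - 'X^V], whose inverse modulo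
   ['X^K] is [1 + geom V]. *)
Lemma theta_geom V : (0 < V)%N ->
  eqm (theta (geom V)) (V%:R *: (geom V * (1 + geom V))).
Proof.
move=> V0; have e1 := geomE V0; set e := geom V in e1 *.
have e2 := eqm_theta e1; rewrite thetaD thetaM !thetaXn in e2.
have hu : eqm ((1 + e) * (1 - 'X^V)) 1.
  have -> : (1 + e) * (1 - 'X^V) = 1 + (e - ('X^V + 'X^V * e)) by ring.
  rewrite -[X in eqm _ X]addr0; apply: eqmD => //.
  by rewrite -(subrr ('X^V + 'X^V * e)); apply: eqmB.
apply: (@eqm_trans ((1 + e) * (1 - 'X^V) * theta e)).
  by rewrite -[X in eqm X _]mul1r; apply: eqmM => //; apply: eqm_sym.
have -> : (1 + e) * (1 - 'X^V) * theta e
    = (1 + e) * (theta e - 'X^V * theta e) by ring.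
apply: (@eqm_trans ((1 + e) * (V%:R *: ('X^V + 'X^V * e)))).
  apply: eqmM => //.
  have -> : V%:R *: ('X^V + 'X^V * e) = (V%:R *: 'X^V + (V%:R *: 'X^V * e +
     'X^V * theta e)) - 'X^V * theta e.
    by rewrite scalerDr -!scalerAl; ring.
  exact: eqmB.
rewrite -scalerAr mulrC; apply: eqmZ; apply: eqmM => //.
exact: eqm_sym.
Qed.

End Truncation.

(** * Nested sums and conjugation of partitions *)

Lemma sum_nat_split (A : nmodType) (K V : nat) (P : pred nat) (F : nat -> A) :
  (V < K)%N -> P V ->
  \sum_(0 <= i < K | P i) F i = \sum_(0 <= i < K | P i && (i < V)%N) F i + F V
                             + \sum_(0 <= i < K | P i && (V < i)%N) F i.
Proof.
move=> VK PV.
have <- : \sum_(0 <= i < K | i == V) F i = F V by rewrite big_nat1_eq VK.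
rewrite big_mkcond [X in _ = X + _ + _]big_mkcond [X in _ = _ + X + _]big_mkcond.
rewrite [X in _ = _ + X]big_mkcond -!big_split /=; apply: eq_bigr => i _.
by case: ltngtP => [_|_|->]; rewrite ?PV ?andbT ?andbF ?add0r ?addr0.
Qed.

Section NestedSums.
Variable C : comNzRingType.
Implicit Types (phi psi : nat -> C) (phis : seq (nat -> C)) (K : nat).

Definition divser K u phi : {poly C} :=
  locked (\sum_(0 <= v < K | (0 < v)%N) phi v *: 'X^(u * v)).

Lemma divser_sumE K u phi :
  divser K u phi = \sum_(0 <= v < K | (0 < v)%N) phi v *: 'X^(u * v).
Proof. by rewrite /divser -lock. Qed.

(* [usum] is the generating series of the definition of an MDF, organised by
   u_1 > u_2 > ...; [vsum] is the same series after conjugation of partitions,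
   organised by the partial sums V_i = v_1 + ... + v_i.  Both are truncated. *)
Fixpoint usum K B phis : {poly C} :=
  if phis is phi :: phis' then
    \sum_(0 <= u < K | (0 < u < B)%N) divser K u phi * usum K u phis'
  else 1.

Fixpoint vsum K a phis : {poly C} :=
  if phis is phi :: phis' then
    \sum_(0 <= V < K | (a < V)%N) phi (V - a)%N *: (geom C K V * vsum K V phis')
  else 1.

Lemma divser0 N K u phi : (N <= u)%N -> eqm N (divser K u phi) 0.
Proof.
move=> Nu; rewrite divser_sumE; apply: eqm_sum0 => v v0.
rewrite -(scaler0 _ (phi v)); apply: eqmZ.
by apply: eqm_Xn0; rewrite (leq_trans Nu) // leq_pmulr.
Qed.

(** Conjugation, one letter at a time: summing ['X^(u * V)] over u > u2 gives ['X^(u2 * V)] times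
    [geom C K V], and the factor ['X^(u2 * v)] of the next letter turns V into the next partial sum
    V + v. *)
Lemma vsum_geom K V phis : (0 < V)%N ->
  eqm K (\sum_(0 <= u < K | (0 < u)%N) 'X^(u * V) * usum K u phis)
        (geom C K V * vsum K V phis).
Proof.
elim: phis V => [|phi phis IH] V V0 /=.
  by rewrite mulr1 geom_sumE; under eq_bigr do rewrite mulr1.
have -> : \sum_(0 <= u < K | (0 < u)%N) 'X^(u * V) *
      (\sum_(0 <= u2 < K | (0 < u2 < u)%N) divser K u2 phi * usum K u2 phis)
   = \sum_(0 <= u2 < K | (0 < u2)%N) (\sum_(0 <= u < K | (u2 < u)%N) 'X^(u * V))
        * (divser K u2 phi * usum K u2 phis).
  under eq_bigr do rewrite mulr_sumr.
  rewrite (exchange_big_dep (fun u2 => (0 < u2)%N)) /=; last by lia.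
  apply: eq_bigr => u2 u20; rewrite [RHS]mulr_suml; apply: eq_bigl => u; lia.
apply: (@eqm_trans _ _ (\sum_(0 <= u2 < K | (0 < u2)%N)
    ('X^(u2 * V) * geom C K V) * (divser K u2 phi * usum K u2 phis))).
  by apply: eqm_sum => u2 _; apply: eqmM => //; apply: geom_shift.
have -> : \sum_(0 <= u2 < K | (0 < u2)%N)
    ('X^(u2 * V) * geom C K V) * (divser K u2 phi * usum K u2 phis)
  = geom C K V * \sum_(0 <= v < K | (0 < v)%N) phi v *:
     \sum_(0 <= u2 < K | (0 < u2)%N) 'X^(u2 * (V + v)) * usum K u2 phis.
  under [in RHS]eq_bigr do rewrite scaler_sumr.
  rewrite exchange_big mulr_sumr; apply: eq_bigr => u _.
  rewrite divser_sumE mulr_suml !mulr_sumr; apply: eq_bigr => v _.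
  rewrite mulnDr exprD -!scalerAl -!scalerAr. congr (_ *: _); ring.
apply: eqmM => //.
pose F W := phi (W - V)%N *: (geom C K W * vsum K W phis).
apply: (@eqm_trans _ _ (\sum_(0 <= v < K | (0 < v)%N) F (V + v)%N)).
  by apply: eqm_sum => v _; rewrite /F addKn; apply/eqmZ/IH; rewrite ltn_addr.
apply: eqm_shift => W KW; rewrite /F -(scaler0 _ (phi (W - V)%N)); apply: eqmZ.
exact/eqmM0/geom0.
Qed.

Lemma usum_vsum K phis : eqm K (usum K K phis) (vsum K 0 phis).
Proof.
case: phis => [|phi phis] //=.
have -> : \sum_(0 <= u < K | (0 < u < K)%N) divser K u phi * usum K u phis
  = \sum_(0 <= v < K | (0 < v)%N) phi v *:
      \sum_(0 <= u < K | (0 < u)%N) 'X^(u * v) * usum K u phis.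
  under [in RHS]eq_bigr do rewrite scaler_sumr.
  rewrite exchange_big; rewrite big_nat_cond [RHS]big_nat_cond.
  apply: eq_big => [u|u _]; first by lia.
  by rewrite divser_sumE mulr_suml; apply: eq_bigr => v _; rewrite scalerAl.
apply: eqm_sum => v v0; rewrite subn0; apply: eqmZ; exact: vsum_geom.
Qed.

Lemma usum_trunc N K B phis : (N <= K)%N -> eqm N (usum K B phis) (usum N B phis).
Proof.
move=> NK; elim: phis B => [|phi phis IH] B //=.
apply: (@eqm_trans _ _ (\sum_(0 <= u < K | (0 < u < B)%N)
    divser N u phi * usum N u phis)).
  apply: eqm_sum => u /andP[u0 _]; apply: eqmM => //.
  rewrite !divser_sumE; apply: eqm_sum_trunc => // v Nv; rewrite -(scaler0 _ (phi v)).
  by apply/eqmZ/eqm_Xn0; rewrite (leq_trans Nv) // leq_pmull.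
apply: eqm_sum_trunc => // u Nu; apply/eqmM0/divser0 => //.
Qed.

(** [n.+1] is the smallest truncation that sees q^n; as a bound on u it loses nothing, since u > n
    contributes only beyond q^n. *)
Definition ucoef phis : nat -> C := fun n => (usum n.+1 n.+1 phis)`_n.

Lemma coef_usum K B n phis : (n < K)%N -> (n < B)%N ->
  (usum K B phis)`_n = ucoef phis n.
Proof.
move=> nK nB; rewrite (@usum_trunc n.+1 K B phis nK) //.
rewrite /ucoef; case: phis => [|phi phis] //=; congr (nth _ (polyseq _) _).
rewrite big_nat_cond [RHS]big_nat_cond; apply: eq_bigl => u; lia.
Qed.

(** The letter produced when two equal values of u merge; both parts w - v and v stay positive. *)
Definition pos_conv psi phi : nat -> C :=
  fun w => \sum_(0 <= v < w | (0 < v)%N) psi (w - v)%N * phi v.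

(** Quasi-shuffle of the single letter [psi] with a word: it is put in front, merged with the first
    letter, or moved past it. *)
Fixpoint stuffle psi phis : seq (seq (nat -> C)) :=
  if phis is phi :: phis' then
    [:: psi :: phi :: phis', pos_conv psi phi :: phis'
      & [seq phi :: x | x <- stuffle psi phis']]
  else [:: [:: psi]].

(** Products are collected by the sum w of the two parts; as u > 0, the terms with w >= K vanish
    modulo ['X^K]. *)
Lemma divserM K u psi phi : (0 < u)%N ->
  eqm K (divser K u psi * divser K u phi) (divser K u (pos_conv psi phi)).
Proof.
move=> u0; pose F v w : {poly C} := (psi (w - v)%N * phi v) *: 'X^(u * w).
have -> : divser K u psi * divser K u phi =
   \sum_(0 <= v < K | (0 < v)%N) \sum_(0 <= w < K | (0 < w)%N) F v (v + w)%N.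
  rewrite mulrC !divser_sumE mulr_suml; apply: eq_bigr => v _; rewrite mulr_sumr.
  apply: eq_bigr => w _; rewrite /F addKn mulnDr exprD -!scalerAl -!scalerAr.
  by rewrite scalerA mulrC.
apply: (@eqm_trans _ _ (\sum_(0 <= v < K | (0 < v)%N)
    \sum_(0 <= w < K | (v < w)%N) F v w)).
  apply: eqm_sum => v _; apply: eqm_shift => w Kw; rewrite /F.
  rewrite -(scaler0 _ (psi (w - v)%N * phi v)); apply/eqmZ/eqm_Xn0.
  by rewrite (leq_trans Kw) // leq_pmull.
rewrite (exchange_big_dep (fun w => (0 < w)%N)) /=; last by lia.
rewrite [divser K u (pos_conv _ _)]divser_sumE big_nat_cond [X in eqm _ _ X]big_nat_cond.
apply: eqm_sum => w /andP[/andP[_ wK] w0].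
by rewrite /pos_conv scaler_suml [X in eqm _ _ X](big_nat_widen _ _ K) //; apply: ltnW.
Qed.

(** The u attached to [psi] is larger than, equal to or smaller than the first u of [phis]; the last
    case is the induction. *)
Lemma usum_stuffle K B psi phis :
  eqm K (usum K B [:: psi] * usum K B phis)
        (\sum_(x <- stuffle psi phis) usum K B x).
Proof.
elim: phis B => [|phi phis IH] B /=; first by rewrite big_seq1 mulr1.
rewrite !big_cons big_map /=.
rewrite mulr_sumr.
pose G u := divser K u phi * usum K u phis.
have -> : \sum_(0 <= u < K | (0 < u < B)%N)
      (\sum_(0 <= u' < K | (0 < u' < B)%N) divser K u' psi * 1) * G u
  = \sum_(0 <= u < K | (0 < u < B)%N) (divser K u psi *
        \sum_(0 <= u' < K | (0 < u' < u)%N) G u')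
  + (\sum_(0 <= u < K | (0 < u < B)%N)
        (divser K u psi * divser K u phi) * usum K u phis
  + \sum_(0 <= u < K | (0 < u < B)%N) divser K u phi *
        (usum K u [:: psi] * usum K u phis)).
  have -> : \sum_(0 <= u < K | (0 < u < B)%N) (divser K u psi *
        \sum_(0 <= u' < K | (0 < u' < u)%N) G u')
    = \sum_(0 <= u < K | (0 < u < B)%N)
        (\sum_(0 <= u' < K | ((0 < u' < B) && (u < u'))%N) divser K u' psi) * G u.
    under eq_bigr do rewrite mulr_sumr.
    rewrite (exchange_big_dep (fun u => (0 < u < B)%N)) /=; last by lia.
    apply: eq_bigr => u uB; rewrite [RHS]mulr_suml; apply: eq_bigl => u'; lia.
  rewrite -!big_split /= big_nat_cond [RHS]big_nat_cond.
  apply: eq_bigr => u /andP[/andP[_ uK] uB].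
  rewrite (@sum_nat_split _ K u) // mulr1 /G /=.
  rewrite (eq_bigl (fun i => (0 < i < u)%N)); last by move=> i; lia.
  under eq_bigr do rewrite mulr1.
  under [X in _ + _ + X]eq_bigr do rewrite mulr1.
  ring.
apply: eqmD => //; apply: eqmD.
  by apply: eqm_sum => u /andP[u0 _]; apply: eqmM => //; apply: divserM.
rewrite exchange_big /=; apply: eqm_sum => u uB; rewrite -mulr_sumr.
by apply: eqmM => //; apply: IH.
Qed.

End NestedSums.

(** * The derivative of a nested sum *)

Section ThetaOfNestedSums.
Variables (C : comNzRingType) (K : nat).
Implicit Types (phi : nat -> C) (phis : seq (nat -> C)) (F G : nat -> {poly C}).

(** One step of [vsum] with the inner nested sum replaced by an arbitrary function of the current
    partial sum, so that linear operations can be moved across it. *)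
Definition vstep a phi F : {poly C} :=
  \sum_(0 <= V < K | (a < V)%N) phi (V - a)%N *: (geom C K V * F V).

Lemma eq_vstep a phi F G : F =1 G -> vstep a phi F = vstep a phi G.
Proof. by move=> FG; apply: eq_bigr => V _; rewrite FG. Qed.

Lemma vstepD a phi F G :
  vstep a phi (fun V => F V + G V) = vstep a phi F + vstep a phi G.
Proof.
by rewrite -big_split; apply: eq_bigr => V _; rewrite mulrDr scalerDr.
Qed.

Lemma vstepZ a phi c F :
  vstep a phi (fun V => c *: F V) = c *: vstep a phi F.
Proof.
rewrite scaler_sumr; apply: eq_bigr => V _.
by rewrite -scalerAr !scalerA mulrC.
Qed.

Lemma vstep_sum (I : Type) (r : seq I) (P : pred I) a phi (F : I -> nat -> {poly C}) :
  vstep a phi (fun V => \sum_(i <- r | P i) F i V) =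
  \sum_(i <- r | P i) vstep a phi (F i).
Proof.
rewrite exchange_big; apply: eq_bigr => V _.
by rewrite mulr_sumr scaler_sumr.
Qed.

(** For [a = 0] this is the truncation of [2;0] with the sum over u carried out. *)
Definition tau a : {poly C} :=
  \sum_(0 <= W < K | (a < W)%N) W%:R *: geom C K W.

(* [vsum_ins] sums over all ways of inserting one more partial sum W, different
   from all the V_i, with weight W; [vsum_mul] weights [vsum] by the sum of
   the V_i. *)
Fixpoint vsum_ins a phis : {poly C} :=
  if phis is phi :: phis' then
    vstep a phi (fun V => vsum_ins V phis' +
      (\sum_(0 <= W < K | (a < W < V)%N) W%:R *: geom C K W) * vsum K V phis')
  else tau a.

Fixpoint vsum_mul a phis : {poly C} :=
  if phis is phi :: phis' then
    vstep a phi (fun V => vsum_mul V phis' + V%:R *: vsum K V phis')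
  else 0.

(** By the Leibniz rule each e(V_i) contributes V_i + V_i e(V_i); the sum of the V_i e(V_i) is all
    of [tau] minus the W that avoid every V_i. *)
Lemma theta_vsum a phis :
  eqm K (theta (vsum K a phis))
        (tau a * vsum K a phis - vsum_ins a phis + vsum_mul a phis).
Proof.
elim: phis a => [|phi phis IH] a /=.
  by rewrite mulr1 subrr addr0 /theta -polyC1 derivC mulr0.
rewrite theta_sum /vstep mulr_sumr -sumrB -big_split /=.
rewrite big_nat_cond [X in eqm _ _ X]big_nat_cond.
apply: eqm_sum => V /andP[/andP[_ VK] aV].
rewrite thetaZ thetaM -scalerAr -scalerBr -scalerDr; apply: eqmZ.
apply: (@eqm_trans _ _ (V%:R *: (geom C K V * (1 + geom C K V)) * vsum K V phis
   + geom C K V * (tau V * vsum K V phis - vsum_ins V phis + vsum_mul V phis))).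
  apply: eqmD; apply: eqmM => //; apply: theta_geom; exact: leq_ltn_trans aV.
(* Cut at V: the part below V belongs to the insertions, the term at V comes from deriving
   [geom C K V], and the part above V from the induction hypothesis. *)
have -> : tau a = \sum_(0 <= W < K | (a < W < V)%N) W%:R *: geom C K W
    + V%:R *: geom C K V + tau V.
  rewrite /tau (@sum_nat_split _ K V) //; congr (_ + _ + _).
  by apply: eq_bigl => i; lia.
rewrite -!scalerAl -!mul_polyC; set X := \sum_(_ <= _ < _ | _) _.
by apply: eq_eqm; ring.
Qed.

End ThetaOfNestedSums.

(** * Letters in divided powers and their addition formulas *)

Section Letters.
Variable C : numFieldType.
Implicit Types (z : C) (s : seq nat) (zs : seq C).

(** Dividing by (k-1)! absorbs the factorials of an MDF and removes the coefficients from the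
    binomial theorem. *)
Definition letter (k : nat) z (v : nat) : C :=
  z ^+ v * v%:R ^+ k.-1 / (k.-1)`!%:R.

Definition letters s zs : seq (nat -> C) :=
  [seq letter x.1 x.2 | x <- zip s zs].

Lemma natr_fact_neq0 n : n`!%:R != 0 :> C.
Proof. by rewrite pnatr_eq0 -lt0n fact_gt0. Qed.

Lemma letterS k z v : (0 < k)%N -> v%:R * letter k z v = k%:R * letter k.+1 z v.
Proof.
case: k => // k _; rewrite /letter /= exprS factS natrM.
have k0 : k.+1%:R != 0 :> C by rewrite pnatr_eq0.
by have f0 := natr_fact_neq0 k; field; rewrite f0 -natr1 addrC in k0 *.
Qed.

(** The binomial theorem in divided powers, the source of the sums over a + b = s_j + 1. *)
Lemma letterD k z v w : (0 < k)%N ->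
  letter k z (v + w) = \sum_(1 <= a < k.+1) letter a z v * letter (k.+1 - a) z w.
Proof.
case: k => // k _; rewrite big_add1 /= big_mkord /letter /=.
rewrite natrD exprDn mulr_sumr mulr_suml (reindex_inj rev_ord_inj) /=.
apply: eq_bigr => i _; have ik : (i <= k)%N by rewrite -ltnS.
rewrite !subSS subKn // bin_sub // subSn //=.
have := bin_fact ik; move/(congr1 (fun n => n%:R : C)); rewrite !natrM => <-.
have f0 := natr_fact_neq0 i; have f1 := natr_fact_neq0 (k - i).
have b0 : 'C(k, i)%:R != 0 :> C by rewrite pnatr_eq0 -lt0n bin_gt0.
by rewrite -mulr_natr exprD; field; rewrite f0 f1 b0.
Qed.

(** Multiplying by v raises the index of the first letter, whence a + b = k + 2; in the new
    numbering a = 1 has weight zero. *)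
Lemma letterD_weighted k z v w : (0 < k)%N ->
  v%:R * letter k z (v + w) =
  \sum_(1 <= a < k.+2) (a - 1)%N%:R * (letter a z v * letter (k.+2 - a) z w).
Proof.
move=> k0; rewrite big_ltn // subnn mul0r add0r big_add1 /= letterD // mulr_sumr.
apply: eq_big_nat => a /andP[a0 _].
by rewrite mulrA letterS // subSS subSS subn0 mulrA.
Qed.

End Letters.

(** * Expansion in terms of multiple divisor functions *)

Section Expansion.
Variables (C : numFieldType) (K : nat).
Implicit Types (z : C) (s : seq nat) (zs : seq C) (F : nat -> {poly C}).

Local Notation vstep := (@vstep C K).

Lemma vstep_letterS a k z F : (0 < k)%N ->
  vstep a (letter k z) (fun V => V%:R *: F V) =
  a%:R *: vstep a (letter k z) F + k%:R *: vstep a (letter k.+1 z) F.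
Proof.
move=> k0; rewrite !scaler_sumr -big_split; apply: eq_bigr => V aV /=.
rewrite -scalerAr !scalerA -scalerDl; congr (_ *: _).
by rewrite -letterS // -mulrDl -natrD subnKC 1?mulrC // ltnW.
Qed.

(** Write W = a + (W - a) and V - a = (W - a) + (V - W), so that the letter at V - a splits over the
    two gaps. *)
Lemma vstep_split a k z F : (0 < k)%N ->
  vstep a (letter k z) (fun V =>
    (\sum_(0 <= W < K | (a < W < V)%N) W%:R *: geom C K W) * F V) =
  a%:R *: (\sum_(1 <= p < k.+1)
    vstep a (letter p z) (fun W => vstep W (letter (k.+1 - p) z) F))
  + \sum_(1 <= p < k.+2) (p - 1)%N%:R *:
    vstep a (letter p z) (fun W => vstep W (letter (k.+2 - p) z) F).
Proof.
move=> k0.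
(* [T] is linear in a function of the two gaps, which reduces the claim to an identity between such
   functions. *)
pose T (f : nat -> nat -> C) := \sum_(0 <= W < K | (a < W)%N)
  \sum_(0 <= V < K | (W < V)%N)
    f (W - a)%N (V - W)%N *: (geom C K W * (geom C K V * F V)).
have TE (phi psi : nat -> C) : vstep a phi (fun W => vstep W psi F) =
    T (fun v w => phi v * psi w).
  apply: eq_bigr => W _; rewrite mulr_sumr scaler_sumr; apply: eq_bigr => V _.
  by rewrite -scalerAr scalerA.
have Tsum m n (c : nat -> C) (f : nat -> nat -> nat -> C) :
    \sum_(m <= p < n) c p *: T (f p) =
    T (fun v w => \sum_(m <= p < n) c p * f p v w).
  under eq_bigr do rewrite scaler_sumr; rewrite exchange_big.
  apply: eq_bigr => W _; under eq_bigr do rewrite scaler_sumr.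
  rewrite exchange_big; apply: eq_bigr => V _; rewrite scaler_suml.
  by apply: eq_bigr => p _; rewrite scalerA.
have -> : \sum_(1 <= p < k.+1)
    vstep a (letter p z) (fun W => vstep W (letter (k.+1 - p) z) F)
    = T (fun v w => letter k z (v + w)).
  transitivity (\sum_(1 <= p < k.+1)
      1 *: T (fun v w => letter p z v * letter (k.+1 - p) z w)).
    by apply: eq_bigr => p _; rewrite TE scale1r.
  rewrite Tsum; apply: eq_bigr => W _; apply: eq_bigr => V _; congr (_ *: _).
  by rewrite letterD //; apply: eq_bigr => p _; rewrite mul1r.
under [X in _ + X]eq_bigr do rewrite TE.
rewrite Tsum.
have -> : vstep a (letter k z) (fun V =>
    (\sum_(0 <= W < K | (a < W < V)%N) W%:R *: geom C K W) * F V) =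
  \sum_(0 <= W < K | (a < W)%N) \sum_(0 <= V < K | (W < V)%N)
   (W%:R * letter k z (V - a)) *: (geom C K W * (geom C K V * F V)).
  rewrite (exchange_big_dep (fun V => (a < V)%N)) /=; last by lia.
  apply: eq_bigr => V aV; rewrite mulr_suml mulr_sumr scaler_sumr.
  rewrite (eq_bigl (fun W => (a < W < V)%N)); last by move=> W; lia.
  apply: eq_bigr => W _; rewrite -scalerAl -scalerAr scalerA [_ * W%:R]mulrC.
  by congr (_ *: _); ring.
rewrite /T scaler_sumr -big_split; apply: eq_bigr => W aW /=.
rewrite scaler_sumr -big_split; apply: eq_bigr => V WV /=.
rewrite scalerA -scalerDl; congr (_ *: _).
rewrite -letterD_weighted // -mulrDl -natrD subnKC; last exact: ltnW.
by congr (_ * letter _ _ _); lia.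
Qed.

(** The offset [a] is the partial sum already reached, needed for inductions on the word; [a = 0]
    gives the MDF. *)
Definition vmdf a s zs : {poly C} := vsum K a (letters s zs).

Lemma vmdf_cons a k s z zs :
  vmdf a (k :: s) (z :: zs) = vstep a (letter k z) (fun V => vmdf V s zs).
Proof. by []. Qed.

(** Since V_i = a + v_1 + ... + v_i, the part with 0-based index j occurs in d - j of the d partial
    sums, and [a] in all of them. *)
Lemma vsum_mul_letters a s zs : size zs = size s -> all (fun k => 0 < k)%N s ->
  vsum_mul K a (letters s zs) =
  \sum_(j < size s) ((size s - j) * nth 0 s j)%N%:R *: vmdf a (incr_nth s j) zs
  + (a * size s)%N%:R *: vmdf a s zs.
Proof.
elim: s zs a => [|k s IH] [|z zs] a //=.
  by rewrite big_ord0 muln0 scale0r addr0.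
case=> sz /andP[k0 s0].
under eq_vstep => V do rewrite IH // -addrA -scalerDl -natrD -mulnSr natrM -scalerA.
rewrite vstepD vstep_sum; under [X in X + _]eq_bigr do rewrite vstepZ.
rewrite (vstep_letterS a z (fun V => (size s).+1%:R *: vmdf V s zs)) //.
rewrite !vstepZ !scalerA big_ord_recl /= subn0 -!natrM [(k * _)%N]mulnC.
rewrite addrA addrC addrA; congr (_ + _ + _).
Qed.

(** All insertions of W with weight 1: the coefficient of [a] when W is written as [a] plus gaps. *)
Definition ins_count a s zs : {poly C} :=
  vmdf a (rcons s 1%N) (rcons zs 1) +
  \sum_(j < size s) \sum_(1 <= p < (nth 0 s j).+1)
    vmdf a (take j s ++ [:: p; (nth 0 s j).+1 - p] ++ drop j.+1 s)%N
           (take j.+1 zs ++ drop j zs).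

(** W inserted after V_d, weighted by the v_j it contains; its last gap W - V_d gives the word
    ending in 2 instead. *)
Definition ins_last_mul a s zs : {poly C} := \sum_(j < size s)
  (nth 0%N s j)%:R *: vmdf a (rcons (incr_nth s j) 1%N) (rcons zs 1).

(** W inserted between V_(j-1) and V_j, weighted by the gap W - V_(j-1). *)
Definition ins_split_here a s zs : {poly C} := \sum_(j < size s)
  \sum_(1 <= p < (nth 0 s j).+2) (p - 1)%N%:R *:
    vmdf a (take j s ++ [:: p; (nth 0 s j).+2 - p] ++ drop j.+1 s)%N
           (take j.+1 zs ++ drop j zs).

(** W inserted at the same place, weighted by the parts v_l with l < j. *)
Definition ins_split_left a s zs : {poly C} :=
  \sum_(j < size s) \sum_(l < size s | (l < j)%N)
  \sum_(1 <= p < (nth 0 s j).+1) (nth 0%N s l)%:R *: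
    vmdf a (take j (incr_nth s l) ++ [:: p; (nth 0 s j).+1 - p] ++ drop j.+1 s)%N
           (take j.+1 zs ++ drop j zs).

Lemma vstep_ins_count a k z s zs :
  vstep a (letter k z) (fun V => ins_count V s zs) +
  \sum_(1 <= p < k.+1) vstep a (letter p z) (fun W =>
     vstep W (letter (k.+1 - p) z) (fun V => vmdf V s zs))
  = ins_count a (k :: s) (z :: zs).
Proof.
rewrite {2}/ins_count /= big_ord_recl /= take0 drop0 vstepD -addrA.
congr (_ + _); rewrite addrC vstep_sum; congr (_ + _).
by apply: eq_bigr => j _; rewrite vstep_sum.
Qed.

Lemma vstep_ins_last a k z s zs :
  k%:R *: vmdf a (rcons (k.+1 :: s) 1%N) (rcons (z :: zs) 1) +
  vstep a (letter k z) (fun V => ins_last_mul V s zs) =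
  ins_last_mul a (k :: s) (z :: zs).
Proof.
rewrite /ins_last_mul /= big_ord_recl /=; congr (_ + _).
by rewrite vstep_sum; apply: eq_bigr => j _; rewrite vstepZ.
Qed.

Lemma vstep_ins_split_here a k z s zs :
  \sum_(1 <= p < k.+2) (p - 1)%N%:R *: vstep a (letter p z) (fun W =>
     vstep W (letter (k.+2 - p) z) (fun V => vmdf V s zs)) +
  vstep a (letter k z) (fun V => ins_split_here V s zs) =
  ins_split_here a (k :: s) (z :: zs).
Proof.
rewrite /ins_split_here /= big_ord_recl /= take0 drop0.
congr (_ + _); rewrite vstep_sum; apply: eq_bigr => j _.
by rewrite vstep_sum; apply: eq_bigr => p _; rewrite vstepZ.
Qed.

(** The new index j = 0 has no l below it; for j > 0 the term l = 0 raises the head to [k.+1], and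
    the other l come from the tail. *)
Lemma vstep_ins_split_left a k z s zs :
  \sum_(j < size s) \sum_(1 <= p < (nth 0 s j).+1) k%:R *:
    vstep a (letter k.+1 z) (fun V =>
      vmdf V (take j s ++ [:: p; (nth 0 s j).+1 - p] ++ drop j.+1 s)%N
           (take j.+1 zs ++ drop j zs)) +
  vstep a (letter k z) (fun V => ins_split_left V s zs) =
  ins_split_left a (k :: s) (z :: zs).
Proof.
rewrite /ins_split_left /= big_ord_recl /= [X in _ = X + _]big_pred0 ?add0r //.
rewrite vstep_sum -big_split; apply: eq_bigr => j _ /=.
rewrite [RHS]big_mkcond big_ord_recl /=; congr (_ + _).
rewrite -[RHS]big_mkcond vstep_sum; apply: eq_bigr => l _.
by rewrite vstep_sum; apply: eq_bigr => p _; rewrite vstepZ.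
Qed.

(** In the induction the tail has offset V, and V = a + (V - a) either keeps the head letter with
    factor [a] or raises it. *)
Lemma vsum_ins_letters a s zs : size zs = size s -> all (fun k => 0 < k)%N s ->
  vsum_ins K a (letters s zs) =
  ins_last_mul a s zs + vmdf a (rcons s 2%N) (rcons zs 1) +
  ins_split_here a s zs + ins_split_left a s zs + a%:R *: ins_count a s zs.
Proof.
elim: s zs a => [|k s IH] [|z zs] a //=.
  (* For the empty word W = (W - a) + a, giving a letter of weight 2 and [a] times one of weight
     1. *)
  rewrite /ins_last_mul /ins_split_here /ins_split_left /ins_count !big_ord0.
  rewrite add0r !addr0 /tau /vmdf /= !scaler_sumr -big_split.
  move=> _ _; apply: eq_bigr => W aW; rewrite /= mulr1 scalerA -scalerDl; congr (_ *: _).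
  rewrite /letter /= !expr1n expr1 expr0 (_ : 1`! = 1)%N // fact0.
  rewrite !mul1r !divr1 ?mulr1 -natrD subnK //.
  exact: ltnW.
case=> sz /andP[k0 s0].
under eq_vstep => V do rewrite IH //.
rewrite vstepD (vstep_split a z (fun V => vmdf V s zs)) //.
rewrite !vstepD (vstep_letterS a z (fun V => ins_count V s zs)) //.
rewrite -vstep_ins_count // -vstep_ins_last // -vstep_ins_split_here //.
rewrite -vstep_ins_split_left // scalerDr /=.
have -> : vstep a (letter k.+1 z) (fun V => ins_count V s zs) =
   vmdf a (rcons (k.+1 :: s) 1%N) (rcons (z :: zs) 1) +
   \sum_(j < size s) \sum_(1 <= p < (nth 0 s j).+1)
    vstep a (letter k.+1 z) (fun V =>
      vmdf V (take j s ++ [:: p; (nth 0 s j).+1 - p] ++ drop j.+1 s)%N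
           (take j.+1 zs ++ drop j zs)).
  rewrite vstepD vstep_sum; congr (_ + _).
  by apply: eq_bigr => j _; rewrite vstep_sum.
have -> : \sum_(j < size s) \sum_(1 <= p < (nth 0 s j).+1) k%:R *:
    vstep a (letter k.+1 z) (fun V =>
      vmdf V (take j s ++ [:: p; (nth 0 s j).+1 - p] ++ drop j.+1 s)%N
           (take j.+1 zs ++ drop j zs)) =
   k%:R *: \sum_(j < size s) \sum_(1 <= p < (nth 0 s j).+1)
    vstep a (letter k.+1 z) (fun V =>
      vmdf V (take j s ++ [:: p; (nth 0 s j).+1 - p] ++ drop j.+1 s)%N
           (take j.+1 zs ++ drop j zs)).
  by rewrite scaler_sumr; apply: eq_bigr => j _; rewrite scaler_sumr.
rewrite scalerDr -vmdf_cons.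
move: (k%:R *: _) (k%:R *: _) => x1 x2.
ring.
Qed.

End Expansion.

(** * The coefficients of a multiple divisor function as nested sums *)

Lemma theta_vmdf (C : numFieldType) (K : nat) (s : seq nat) (zs : seq C) :
  size zs = size s -> all (fun k => 0 < k)%N s ->
  eqm K (theta (vmdf K 0 s zs))
    (tau C K 0 * vmdf K 0 s zs
     + \sum_(j < size s)
         ((size s - j) * nth 0 s j)%N%:R *: vmdf K 0 (incr_nth s j) zs
     - (ins_last_mul K 0 s zs + vmdf K 0 (rcons s 2%N) (rcons zs 1) +
        ins_split_here K 0 s zs + ins_split_left K 0 s zs)).
Proof.
move=> sz s0; apply: eqm_trans; first exact: theta_vsum.
rewrite vsum_mul_letters // vsum_ins_letters // mul0n !scale0r !addr0.
by apply: eq_eqm; rewrite addrAC.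
Qed.

(** * Peeling off the first coordinate in sums over finite functions *)

Section FfunSums.
Variables (A : nmodType) (T : finType) (d : nat).

Definition fcons (x : T) (g : {ffun 'I_d -> T}) : {ffun 'I_d.+1 -> T} :=
  [ffun i => oapp g x (unlift ord0 i)].

Lemma fcons0 x g : fcons x g ord0 = x.
Proof. by rewrite ffunE unlift_none. Qed.

Lemma fconsS x g i : fcons x g (lift ord0 i) = g i.
Proof. by rewrite ffunE liftK. Qed.

Lemma big_fcons (F : {ffun 'I_d.+1 -> T} -> A) :
  \sum_f F f = \sum_x \sum_g F (fcons x g).
Proof.
rewrite pair_big /= (reindex (fun p => fcons p.1 p.2)) //=.
exists (fun f : {ffun 'I_d.+1 -> T} => (f ord0, [ffun i => f (lift ord0 i)])).
  move=> [x g] _ /=; rewrite fcons0; congr (_, _).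
  by apply/ffunP => i; rewrite ffunE fconsS.
move=> f _; apply/ffunP => i /=; rewrite ffunE.
by case: unliftP => [j ->|->] //=; rewrite ffunE.
Qed.

Lemma forall_ord_recl (P : pred 'I_d.+1) :
  [forall i, P i] = P ord0 && [forall i, P (lift ord0 i)].
Proof.
apply/forallP/andP => [h|[h0 /forallP h] i]; first by split => //; apply/forallP.
by case: (unliftP ord0 i) => [j ->|->].
Qed.

End FfunSums.

Section UsumFfun.
Variables (C : numFieldType) (K m : nat) (w : C).
Implicit Types (s : seq nat) (al : seq 'I_m.+1).

(** The summation condition of [mdf] without the equation for n; the bound [B] makes it
    recursive. *)
Definition udesc d B (u v : {ffun 'I_d -> 'I_K}) :=
  [&& [forall i, (0 < u i)%N && (0 < v i)%N],
      [forall i : 'I_d, forall j : 'I_d, (i < j)%N ==> (u j < u i)%N] &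
      [forall i, (u i < B)%N]].

Lemma udesc_fcons d B u0 (u v : {ffun 'I_d -> 'I_K}) v0 :
  udesc B (fcons u0 u) (fcons v0 v) =
  [&& (0 < u0 < B)%N, (0 < v0)%N & udesc u0 u v].
Proof.
rewrite /udesc !forall_ord_recl !fcons0 /=.
have -> : [forall i, (0 < fcons u0 u (lift ord0 i)) &&
     (0 < fcons v0 v (lift ord0 i))]%N = [forall i, (0 < u i) && (0 < v i)]%N.
  by apply: eq_forallb => i; rewrite !fconsS.
have -> : [forall i, (fcons u0 u (lift ord0 i) < u0)]%N = [forall i, u i < u0]%N.
  by apply: eq_forallb => i; rewrite !fconsS.
have -> : [forall i, (fcons u0 u (lift ord0 i) < B)]%N = [forall i, u i < B]%N.
  by apply: eq_forallb => i; rewrite !fconsS.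
have -> : [forall i : 'I_d, forall j : 'I_d.+1,
    (lift ord0 i < j)%N ==> (fcons u0 u j < fcons u0 u (lift ord0 i))%N] =
    [forall i : 'I_d, forall j : 'I_d, (i < j)%N ==> (u j < u i)%N].
  apply: eq_forallb => i; rewrite forall_ord_recl /=; apply: eq_forallb => j.
  by rewrite !fconsS /bump /= !add1n ltnS.
case: (boolP [forall i, u i < u0]%N) => [/forallP h|_]; last by rewrite !(andbF, andFb).
case: (ltnP u0 B) => uB; last by rewrite !(andbF, andFb).
(* The tail lies below u0 < B, so its bound by [B] is automatic. *)
have -> : [forall i, u i < B]%N by apply/forallP => i; apply: leq_trans (h i) (ltnW uB).
by rewrite !andbT /= -!andbA.
Qed.

Lemma usum_ffun B s al : size al = size s ->
  usum K B (letters s [seq w ^+ (c : 'I_m.+1) | c <- al]) =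
  \sum_(u : {ffun 'I_(size s) -> 'I_K}) \sum_(v : {ffun 'I_(size s) -> 'I_K})
   if udesc B u v then
    (\prod_(i < size s) letter (nth 0%N s i) (w ^+ nth (0 : 'I_m.+1) al i) (v i))
      *: 'X^(\sum_(i < size s) u i * v i)
   else 0.
Proof.
elim: s al B => [|k s IH] [|c al] B //=.
  move=> _; pose f0 : {ffun 'I_0 -> 'I_K} := ffun0 (card_ord 0).
  have f0P : all_equal_to f0 by move=> f; apply/ffunP => -[].
  rewrite (big_pred1 f0) => [|f]; last by rewrite /= (f0P f) eqxx.
  rewrite (big_pred1 f0) => [|f]; last by rewrite /= (f0P f) eqxx.
  rewrite ifT; first by rewrite !big_ord0 scale1r expr0.
  by apply/and3P; split; apply/forallP => -[].
case=> sz; rewrite big_fcons big_mkord [LHS]big_mkcond; apply: eq_bigr => u0 _.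
under [RHS]eq_bigr do rewrite big_fcons.
rewrite exchange_big /=.
transitivity (\sum_(v0 : 'I_K) if (0 < u0 < B)%N && (0 < v0)%N then
   (letter k (w ^+ c) v0 *: 'X^(u0 * v0)) *
     usum K u0 (letters s [seq w ^+ (c : 'I_m.+1) | c <- al]) else 0).
  case: ifP => uB; last by rewrite big1.
  by rewrite divser_sumE big_mkord mulr_suml big_mkcond.
apply: eq_bigr => v0 _; case: ifP => uv; last first.
  rewrite big1 // => u _; rewrite big1 // => v _.
  by rewrite udesc_fcons andbA uv.
rewrite IH // mulr_sumr; apply: eq_bigr => u _.
rewrite mulr_sumr; apply: eq_bigr => v _.
rewrite udesc_fcons andbA uv /=; case: ifP => _; last by rewrite mulr0.
rewrite !big_ord_recl !fcons0 /= exprD -scalerAl -scalerAr scalerA.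
under [in RHS]eq_bigr do rewrite fconsS.
by under [in X in _ = _ *: (_ * X)]eq_bigr do rewrite !fconsS.
Qed.

End UsumFfun.

Lemma mdf_ucoef (R : realType) (m : nat) (s : seq nat) (al : seq 'I_m.+1) :
  (0 < size s)%N -> size al = size s ->
  mdf R s al = ucoef (letters s [seq Defs.eta R m.+1 ^+ (c : 'I_m.+1) | c <- al]).
Proof.
move=> s0 sz; apply/funext => -[|n].
  (* At q^0 [mdf] is zero by definition, and in [usum] no u satisfies 0 < u < 1. *)
  case: s al s0 sz => [|k s] [|c al] //= _ _.
  by rewrite /ucoef /= big_nat_cond big1 ?coef0 // => u; lia.
rewrite /ucoef usum_ffun // coef_sum [LHS]mulr_sumr; apply: eq_bigr => u _.
rewrite coef_sum mulr_sumr big_mkcond; apply: eq_bigr => v _.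
have uB : [forall i, u i < n.+2]%N by apply/forallP.
rewrite /udesc uB andbT.
case: [forall i, _ && _]; case: [forall i, forall j, _] => /=;
  rewrite ?mulr0 ?coef0 //.
rewrite coefZ coefXn eq_sym; case: eqP => _; last by rewrite !mulr0.
rewrite mulr1 mulrC -prodfV -big_split; apply: eq_bigr => i _.
by rewrite /letter exprM.
Qed.

(** * The formula for the derivative *)

Section QSeries.
Variables (R : realType) (m : nat).
Implicit Types (s : seq nat) (al : seq 'I_m.+1).

Definition colors al : seq R[i] := [seq Defs.eta R m.+1 ^+ (c : 'I_m.+1) | c <- al].

Lemma colors_rcons0 al : colors (rcons al 0) = rcons (colors al) 1.
Proof. by rewrite /colors map_rcons. Qed.

Lemma colors_repeat j al :
  colors (take j.+1 al ++ drop j al) =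
  take j.+1 (colors al) ++ drop j (colors al).
Proof. by rewrite /colors map_cat map_take map_drop. Qed.

Lemma mdf_vmdf s al n : (0 < size s)%N -> size al = size s ->
  mdf R s al n = (vmdf n.+1 0 s (colors al))`_n.
Proof.
move=> s0 sz; rewrite mdf_ucoef // /ucoef.
exact: usum_vsum.
Qed.

Lemma qmul_ucoef (phis psis : seq (nat -> R[i])) n :
  qmul (ucoef phis) (ucoef psis) n =
  (usum n.+1 n.+1 phis * usum n.+1 n.+1 psis)`_n.
Proof.
rewrite coefM; apply: eq_bigr => i _.
rewrite !(@coef_usum _ n.+1 n.+1) // ltnS ?leq_subr // -ltnS //.
Qed.

Lemma size_incr_nth_lt s j : (j < size s)%N -> size (incr_nth s j) = size s.
Proof. by move=> js; rewrite size_incr_nth js. Qed.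

Lemma size_split s j p q : (j < size s)%N ->
  size (take j s ++ [:: p; q] ++ drop j.+1 s) = (size s).+1.
Proof. by move=> js; rewrite !size_cat size_takel ?size_drop /=; lia. Qed.

Lemma size_repeat al j : (j < size al)%N ->
  size (take j.+1 al ++ drop j al) = (size al).+1.
Proof. by move=> js; rewrite size_cat size_takel ?size_drop; lia. Qed.

Lemma qseriesDE (f g : nat -> R[i]) n : (f + g) n = f n + g n.
Proof. by []. Qed.

Lemma qseriesNE (f : nat -> R[i]) n : (- f) n = - f n.
Proof. by []. Qed.

Lemma drop_incr_nth s l j : (l < j)%N -> drop j.+1 (incr_nth s l) = drop j.+1 s.
Proof.
elim: s l j => [|k s IH] [|l] [|j] //= lj; last exact: IH.
by rewrite drop_oversize // size_ncons addn1 ltnW.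
Qed.

Lemma qD_mdf (d : nat) s al :
  (0 < d)%N -> size s = d -> size al = d -> all (fun k => 0 < k)%N s ->
  qD (mdf R s al) =
    qmul (mdf R [:: 2%N] [:: 0 : 'I_m.+1]) (mdf R s al)
    + \sum_(j < d) ((d - j) * nth 0 s j)%N%:R *: mdf R (incr_nth s j) al
    - \sum_(j < d)
        (nth 0%N s j)%:R *: mdf R (rcons (incr_nth s j) 1%N) (rcons al 0)
    - mdf R (rcons s 2%N) (rcons al 0)
    - \sum_(j < d) \sum_(1 <= a < (nth 0 s j + 2)%N)
        (a - 1)%N%:R *:
        mdf R (take j s ++ [:: a; (nth 0 s j + 2 - a)%N] ++ drop j.+1 s)
              (take j.+1 al ++ drop j al)
    - \sum_(j < d) \sum_(l < d | (l < j)%N)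
      \sum_(1 <= a < (nth 0 s j + 1)%N)
        (nth 0%N s l)%:R *:
        mdf R (take j (incr_nth s l)
                 ++ [:: a; (nth 0 s j + 1 - a)%N] ++ drop j.+1 s)
              (take j.+1 al ++ drop j al).
Proof.
move=> d0 sd ald s0; apply/funext => n.
have al_s : size al = size s by rewrite ald.
have s_gt0 : (0 < size s)%N by rewrite sd.
have zs_s : size (colors al) = size s by rewrite size_map.
transitivity ((theta (vmdf n.+1 0 s (colors al)))`_n).
  by rewrite coef_theta /qD mdf_vmdf // mulr_natl.
rewrite theta_vmdf // !(coefD, coefN, opprD) !addrA.
rewrite !(qseriesDE, qseriesNE).
congr (_ + _ - _ - _ - _ - _).
(* [tau] at offset 0 is the conjugated [2;0]; the coefficients i and n - i of the factors are both
   seen modulo ['X^n.+1]. *)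
- rewrite !mdf_ucoef // qmul_ucoef !coefM; apply: eq_bigr => i _.
  rewrite -(@usum_vsum _ n.+1 (letters s (colors al))); last by rewrite ltnS leq_subr.
  congr (_ * _); rewrite (@usum_vsum _ n.+1 _ i (ltn_ord i)).
  rewrite /tau /letters /= expr0; congr (nth _ (polyseq _) _).
  apply: eq_bigr => V _; rewrite subn0 mulr1 /letter /= expr1n mul1r expr1.
  by rewrite (_ : 1`! = 1)%N // divr1.
- rewrite fct_sumE coef_sum sd; apply: eq_bigr => j _.
  by rewrite coefZ -mdf_vmdf ?size_incr_nth_lt // sd.
- rewrite fct_sumE coef_sum sd; apply: eq_bigr => j _.
  rewrite coefZ -colors_rcons0 -mdf_vmdf ?size_rcons ?size_incr_nth_lt ?sd //.
  by rewrite ald.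
- by rewrite -colors_rcons0 -mdf_vmdf ?size_rcons // ald sd.
- rewrite fct_sumE coef_sum sd; apply: eq_bigr => j _.
  rewrite fct_sumE coef_sum addn2; apply: eq_bigr => a _.
  by rewrite coefZ -colors_repeat -mdf_vmdf ?size_split ?size_repeat ?sd ?ald //.
- rewrite fct_sumE coef_sum sd; apply: eq_bigr => j _.
  rewrite fct_sumE coef_sum; apply: eq_bigr => l lj.
  rewrite fct_sumE coef_sum addn1; apply: eq_bigr => a _.
  have ls : (l < size s)%N by rewrite sd.
  rewrite coefZ -colors_repeat.
  rewrite -(drop_incr_nth s lj).
  by rewrite -mdf_vmdf ?size_split ?size_repeat ?size_incr_nth_lt ?sd ?ald //.
Qed.
End QSeries.

(** * Linear spans over the cyclotomic field *)

Section Spans.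
Variables (R : realType) (N : nat).
Implicit Types (x y c : R[i]) (f g : nat -> R[i]) (G H : set (nat -> R[i])).

Local Notation Q := (QN R N).

Lemma QN1 : Q 1.
Proof. by move=> S [? _ _] _. Qed.

Lemma QNB x y : Q x -> Q y -> Q (x - y).
Proof. by move=> hx hy S hS he; case: (hS) => _ h _; apply: h; [apply: hx|apply: hy]. Qed.

Lemma QN_div x y : Q x -> Q y -> Q (x / y).
Proof. by move=> hx hy S hS he; case: (hS) => _ _ h; apply: h; [apply: hx|apply: hy]. Qed.

Lemma QN_eta : Q (Defs.eta R N).
Proof. by []. Qed.

Lemma QN0 : Q 0.
Proof. by rewrite -(subrr 1); apply: QNB; apply: QN1. Qed.

Lemma QNN x : Q x -> Q (- x).
Proof. by move=> hx; rewrite -sub0r; apply: QNB => //; apply: QN0. Qed.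

Lemma QND x y : Q x -> Q y -> Q (x + y).
Proof. by move=> hx hy; rewrite -[y]opprK; apply: QNB => //; apply: QNN. Qed.

Lemma QNV x : Q x -> Q x^-1.
Proof. by move=> hx; rewrite -div1r; apply: QN_div => //; apply: QN1. Qed.

Lemma QNM x y : Q x -> Q y -> Q (x * y).
Proof. by move=> hx hy; rewrite -[y]invrK; apply: QN_div => //; apply: QNV. Qed.

Lemma QN_nat n : Q n%:R.
Proof.
elim: n => [|n IH]; first exact: QN0.
by rewrite -natr1; apply: QND => //; apply: QN1.
Qed.

Lemma QNX x n : Q x -> Q (x ^+ n).
Proof.
move=> hx; elim: n => [|n IH]; first exact: QN1.
by rewrite exprS; apply: QNM.
Qed.

Lemma QN_span_gen G f : G f -> QN_span N G f.
Proof.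
move=> Gf; exists 1%N, (fun=> 1), (fun=> f); split => // [_|].
  exact: QN1.
by rewrite big_ord1 scale1r.
Qed.

Lemma QN_span0 G : QN_span N G 0.
Proof.
exists 0%N, (fun=> 0), (fun=> 0); split => [[]//|[]//|].
by rewrite big_ord0.
Qed.

Lemma QN_spanZ G c f : Q c -> QN_span N G f -> QN_span N G (c *: f).
Proof.
move=> hc [r [a [g [ha hg ->]]]]; exists r, (fun i => c * a i), g; split => //.
  by move=> i; apply: QNM.
by rewrite scaler_sumr; apply: eq_bigr => i _; rewrite scalerA.
Qed.

Lemma QN_spanD G f g : QN_span N G f -> QN_span N G g -> QN_span N G (f + g).
Proof.
move=> [r [a [u [ha hu ->]]]] [t [b [v [hb hv ->]]]].
exists (r + t)%N.
exists (fun i => match fintype.split i with inl j => a j | inr j => b j end).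
exists (fun i => match fintype.split i with inl j => u j | inr j => v j end).
split=> [i|i|]; try by case: fintype.split.
rewrite big_split_ord /=; congr (_ + _); apply: eq_bigr => i _.
  by rewrite (unsplitK (inl i)).
by rewrite (unsplitK (inr i)).
Qed.

Lemma QN_spanN G f : QN_span N G f -> QN_span N G (- f).
Proof. by move=> hf; rewrite -scaleN1r; apply: QN_spanZ => //; apply/QNN/QN1. Qed.

Lemma QN_spanB G f g : QN_span N G f -> QN_span N G g -> QN_span N G (f - g).
Proof. by move=> hf hg; apply: QN_spanD => //; apply: QN_spanN. Qed.

Lemma QN_span_sum G (I : eqType) (r : seq I) (P : pred I) (F : I -> nat -> R[i]) :
  (forall i, i \in r -> P i -> QN_span N G (F i)) ->
  QN_span N G (\sum_(i <- r | P i) F i).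
Proof.
move=> h; rewrite big_seq_cond; elim/big_ind: _ => [|f g|i /andP[ir Pi]].
- exact: QN_span0.
- exact: QN_spanD.
- exact: h.
Qed.

Lemma QN_span_map G H (T : (nat -> R[i]) -> nat -> R[i]) :
  (forall r (c : 'I_r -> R[i]) (g : 'I_r -> nat -> R[i]),
    T (\sum_(i < r) c i *: g i) = \sum_(i < r) c i *: T (g i)) ->
  (forall f, G f -> QN_span N H (T f)) ->
  forall f, QN_span N G f -> QN_span N H (T f).
Proof.
move=> Tlin hT f [r [a [u [ha hu ->]]]]; rewrite Tlin.
by apply: QN_span_sum => i _ _; apply: QN_spanZ => //; apply: hT.
Qed.

Lemma QN_span_sub G H : (forall f, G f -> QN_span N H f) ->
  forall f, QN_span N G f -> QN_span N H f.
Proof. exact: (@QN_span_map G H id). Qed.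

End Spans.

Lemma QN_span_sum_nat (R : realType) (N : nat) (G : set (nat -> R[i])) (m n : nat)
    (F : nat -> nat -> R[i]) :
  (forall i, (m <= i < n)%N -> QN_span N G (F i)) ->
  QN_span N G (\sum_(m <= i < n) F i).
Proof. by move=> h; apply: QN_span_sum => i; rewrite mem_index_iota => /h. Qed.

(** * Power sums and convolutions of letters *)

Section PowerSums.
Variable C : comNzRingType.
Implicit Types (z : C).

(** For w > 0 the index v = 0 is included and contributes [0 ^+ k], which is 1 when k = 0. *)
Definition power_sum z k (w : nat) : C := \sum_(0 <= v < w) z ^+ v * v%:R ^+ k.

(** Telescoping of z^v v^j over v < w, with (v + 1)^j expanded by the binomial theorem. *)
Lemma power_sum_rec z j w :
  z ^+ w * w%:R ^+ j - 0 ^+ j =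
  z * (\sum_(i < j) 'C(j, i)%:R * power_sum z i w) + (z - 1) * power_sum z j w.
Proof.
have -> : z * (\sum_(i < j) 'C(j, i)%:R * power_sum z i w)
    + (z - 1) * power_sum z j w =
  z * (\sum_(i < j.+1) 'C(j, i)%:R * power_sum z i w) - power_sum z j w.
  by rewrite big_ord_recr /= binn; ring.
have -> : \sum_(i < j.+1) 'C(j, i)%:R * power_sum z i w =
    \sum_(0 <= v < w) z ^+ v * v.+1%:R ^+ j.
  rewrite /power_sum; under eq_bigr do rewrite mulr_sumr.
  rewrite exchange_big; apply: eq_bigr => v _; rewrite -natr1 [_ + 1]addrC exprDn.
  rewrite mulr_sumr; apply: eq_bigr => i _.
  by rewrite expr1n mul1r -mulr_natl; ring.
rewrite /power_sum mulr_sumr -sumrB.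
have := telescope_sumr (fun v => z ^+ v * v%:R ^+ j) (leq0n w).
rewrite /= expr0 mul1r mulr0n => <-.
by apply: eq_bigr => v _; rewrite exprS mulrA.
Qed.

End PowerSums.

Section LetterSpan.
Variables (R : realType) (m : nat).
Implicit Types (f g : nat -> R[i]) (c : 'I_m.+1).

Local Notation e c := (Defs.eta R m.+1 ^+ (nat_of_ord c)).

Definition letter_span k := QN_span m.+1 [set f : nat -> R[i] |
  exists j c, (0 < j <= k)%N /\ f = letter j (e c)].

Lemma letter_span_le k l f : (k <= l)%N -> letter_span k f -> letter_span l f.
Proof.
move=> kl; apply: QN_span_sub => {}f [j [c [/andP[j0 jk] ->]]].
by apply: QN_span_gen; exists j, c; rewrite j0 (leq_trans jk).
Qed.

Lemma letter_in_span k c : (0 < k)%N -> letter_span k (letter k (e c)).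
Proof. by move=> k0; apply: QN_span_gen; exists k, c; rewrite k0 leqnn. Qed.

Lemma monomial_in_span k c :
  letter_span k.+1 (fun w => e c ^+ w * w%:R ^+ k).
Proof.
have -> : (fun w => e c ^+ w * w%:R ^+ k) = (k`!)%:R *: letter k.+1 (e c).
  apply/funext => w; rewrite /letter /= /GRing.scale /=.
  by rewrite [RHS]mulrC divfK // natr_fact_neq0.
by apply: QN_spanZ; [apply: QN_nat|apply: letter_in_span].
Qed.

Lemma one_in_span k : letter_span k.+1 (fun=> 1).
Proof.
apply: (@letter_span_le 1) => //; have := @monomial_in_span 0 0.
by congr (letter_span _ _); apply/funext => w; rewrite expr0 expr1n mulr1.
Qed.

Lemma letter_span_mulw k f : letter_span k f ->
  letter_span k.+1 (fun w => w%:R * f w).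
Proof.
apply: (@QN_span_map _ _ _ _ (fun f w => w%:R * f w)) => [r a g|{}f].
  apply/funext => w; rewrite !fct_sumE mulr_sumr; apply: eq_bigr => i _.
  by rewrite /GRing.scale /= mulrCA.
move=> [j [c [/andP[j0 jk] ->]]].
have -> : (fun w => w%:R * letter j (e c) w) = j%:R *: letter j.+1 (e c).
  by apply/funext => w; rewrite letterS.
apply: QN_spanZ; first exact: QN_nat.
by apply: (@letter_span_le j.+1) => //; apply: letter_in_span.
Qed.

Lemma power_sum_in_span c k : letter_span k.+2 (power_sum (e c) k).
Proof.
elim/ltn_ind: k => k IH.
have Qe : QN R m.+1 (e c) by apply: QNX; apply: QN_eta.
have hS (b : 'I_k -> R[i]) : (forall i, QN R m.+1 (b i)) ->
    letter_span k.+2 (\sum_(i < k) b i *: power_sum (e c) i).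
  move=> hb; apply: QN_span_sum => i _ _; apply: QN_spanZ => //.
  by apply: (@letter_span_le i.+2); [rewrite !ltnS ltnW|apply: IH].
have hM j : (j <= k.+1)%N -> letter_span k.+2 (fun w => e c ^+ w * w%:R ^+ j).
  by move=> jk; apply: (@letter_span_le j.+1) => //; apply: monomial_in_span.
(* Let P_j be the power sums. For z = 1 the term (z - 1) P_j drops out, so the recursion is taken at
   j = k + 1, where P_k has coefficient k + 1. *)
have [e1|ne1] := eqVneq (e c) 1.
  have -> : power_sum (e c) k = k.+1%:R^-1 *: ((fun w => e c ^+ w * w%:R ^+ k.+1)
      - \sum_(i < k) 'C(k.+1, i)%:R *: power_sum (e c) i).
    apply/funext => w; have := power_sum_rec (e c) k.+1 w.
    rewrite e1 subrr mul0r addr0 mul1r expr0n subr0 big_ord_recr /= binSn.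
    have k0 : k.+1%:R != 0 :> R[i] by rewrite pnatr_eq0.
    have -> (g : nat -> R[i]) : (k.+1%:R^-1 *: g) w = k.+1%:R^-1 * g w by [].
    rewrite qseriesDE qseriesNE fct_sumE => ->.
    by rewrite [X in X - _]addrC addrK mulKf.
  apply: QN_spanZ; first by apply/QNV/QN_nat.
  by apply: QN_spanB; [apply: hM|apply: hS => i; apply: QN_nat].
(* For z different from 1 the recursion at j = k is solved for P_k by dividing by z - 1. *)
have -> : power_sum (e c) k = (e c - 1)^-1 *: ((fun w => e c ^+ w * w%:R ^+ k)
    - (0 ^+ k) *: (fun=> 1) - \sum_(i < k) (e c * 'C(k, i)%:R) *: power_sum (e c) i).
  apply/funext => w; have := power_sum_rec (e c) k w.
  have e0 : e c - 1 != 0 by rewrite subr_eq0.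
  have sE a (g : nat -> R[i]) : (a *: g) w = a * g w by [].
  rewrite sE !(qseriesDE, qseriesNE) fct_sumE sE mulr1 => ->.
  rewrite mulr_sumr; under [X in X + _ - _]eq_bigr do rewrite mulrA.
  by rewrite [X in X - _]addrC addrK mulKf.
apply: QN_spanZ; first by apply/QNV/QNB => //; apply: QN1.
apply: QN_spanB; last by apply: hS => i; apply: QNM => //; apply: QN_nat.
apply: QN_spanB; first exact: hM.
apply: QN_spanZ; last exact: one_in_span.
by apply/QNX/QN0.
Qed.

(** Up to a factorial the convolution sums (w - v) z^v v^(k-1) over 0 < v < w, which is w P_(k-1) -
    P_k without the term v = 0. *)
Lemma conv_in_span k c : (0 < k)%N ->
  letter_span k.+2 (pos_conv (letter 2 (1 : R[i])) (letter k (e c))).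
Proof.
case: k => // k _.
have -> : pos_conv (letter 2 (1 : R[i])) (letter k.+1 (e c)) = (k`!)%:R^-1 *:
   ((fun w => w%:R * power_sum (e c) k w) - power_sum (e c) k.+1
    - (0 ^+ k) *: (fun w => w%:R * 1)).
  apply/funext => w.
  have sE a (g : nat -> R[i]) : (a *: g) w = a * g w by [].
  rewrite sE !(qseriesDE, qseriesNE) sE mulr1.
  have -> : pos_conv (letter 2 (1 : R[i])) (letter k.+1 (e c)) w = (k`!)%:R^-1 *
     \sum_(0 <= v < w | (0 < v)%N) (w%:R - v%:R) * (e c ^+ v * v%:R ^+ k).
    rewrite /pos_conv mulr_sumr big_nat_cond [RHS]big_nat_cond.
    apply: eq_bigr => v /andP[/andP[_ vw] _].
    rewrite /letter /= expr1n expr1 mul1r (_ : 1`! = 1)%N // divr1.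
    by rewrite natrB; [ring|apply: ltnW].
  congr (_ * _).
  have -> : w%:R * power_sum (e c) k w - power_sum (e c) k.+1 w =
     \sum_(0 <= v < w) (w%:R - v%:R) * (e c ^+ v * v%:R ^+ k).
    rewrite /power_sum mulr_sumr -sumrB; apply: eq_bigr => v _.
    by rewrite exprS; ring.
  (* For w = 0 the sums are empty; for w > 0 the subtracted [0 ^+ k] times w is the summand v =
     0. *)
  case: w {sE} => [|w]; first by rewrite !big_geq // mulr0 subr0.
  rewrite [X in _ = X - _]big_ltn // [LHS]big_ltn_cond //= expr0 mul1r subr0.
  rewrite mulr0n mulrC [X in X - _]addrC addrK big_nat_cond [RHS]big_nat.
  by apply: eq_bigl => v; rewrite andbAC andbb.
apply: QN_spanZ; first by apply/QNV/QN_nat.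
apply: QN_spanB; last first.
  apply: QN_spanZ; first by apply/QNX/QN0.
  exact/letter_span_mulw/one_in_span.
apply: QN_spanB; last exact: power_sum_in_span.
exact/letter_span_mulw/power_sum_in_span.
Qed.

End LetterSpan.

(** * The weight and depth filtration *)

Lemma divser_lincomb (C : comNzRingType) K u r (c : 'I_r -> C)
    (phi : 'I_r -> nat -> C) :
  divser K u (fun v => \sum_(i < r) c i * phi i v) =
  \sum_(i < r) c i *: divser K u (phi i).
Proof.
rewrite divser_sumE; under eq_bigr do rewrite scaler_suml.
rewrite exchange_big; apply: eq_bigr => i _.
by rewrite divser_sumE scaler_sumr; apply: eq_bigr => v _; rewrite scalerA.
Qed.

Lemma usum_lincomb (C : comNzRingType) K B (pre post : seq (nat -> C)) r
    (c : 'I_r -> C) (phi : 'I_r -> nat -> C) :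
  usum K B (pre ++ (fun v => \sum_(i < r) c i * phi i v) :: post) =
  \sum_(i < r) c i *: usum K B (pre ++ phi i :: post).
Proof.
elim: pre B => [|psi pre IH] B /=.
  under eq_bigr do rewrite divser_lincomb mulr_suml.
  rewrite exchange_big; apply: eq_bigr => i _; rewrite scaler_sumr.
  by apply: eq_bigr => u _; rewrite scalerAl.
under eq_bigr do rewrite IH mulr_sumr.
rewrite exchange_big; apply: eq_bigr => i _; rewrite scaler_sumr.
by apply: eq_bigr => u _; rewrite scalerAr.
Qed.

Section FilClosure.
Variables (R : realType) (m : nat).
Implicit Types (s : seq nat) (al : seq 'I_m.+1) (phis : seq (nat -> R[i])).

Lemma qseries_lincombE r (c : 'I_r -> R[i]) (g : 'I_r -> nat -> R[i]) n :
  (\sum_(i < r) c i *: g i) n = \sum_(i < r) c i * g i n.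
Proof. by rewrite fct_sumE; apply: eq_bigr. Qed.

Lemma Fil_le k l d d' f : (k <= l)%N -> (d <= d')%N -> Fil R m k d f -> Fil R m l d' f.
Proof.
move=> kl dd; apply: QN_span_sub => {}f [s [al [sf sk sd]]].
by apply: QN_span_gen; exists s, al; split=> //; [apply: leq_trans kl|apply: leq_trans dd].
Qed.

Lemma mdf_Fil s al k d : (0 < size s)%N -> size al = size s ->
  all (fun k => 0 < k)%N s -> (sumn s <= k)%N -> (size s <= d)%N ->
  Fil R m k d (mdf R s al).
Proof. by move=> *; apply: QN_span_gen; exists s, al. Qed.

Lemma letters_rcons s al j c : size al = size s ->
  letters (rcons s j) (colors R (rcons al c)) =
  rcons (letters s (colors R al)) (letter j (Defs.eta R m.+1 ^+ nat_of_ord c)).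
Proof.
move=> sz; rewrite /letters /colors map_rcons zip_rcons ?size_map //.
by rewrite map_rcons.
Qed.

Fixpoint in_letter_spans ks phis : Prop :=
  match ks, phis with
  | [::], [::] => True
  | k :: ks', phi :: phis' => @letter_span R m k phi /\ in_letter_spans ks' phis'
  | _, _ => False
  end.

Lemma in_letter_spans_letters s al : size al = size s ->
  all (fun k => 0 < k)%N s -> in_letter_spans s (letters s (colors R al)).
Proof.
elim: s al => [|k s IH] [|c al] //= [sz] /andP[k0 s0].
by split; [apply: letter_in_span|apply: IH].
Qed.

(** Letters are expanded from left to right by multilinearity; [s] and [al] describe the prefix
    already made of genuine letters. *)
Lemma ucoef_Fil s al ks phis : size al = size s -> all (fun k => 0 < k)%N s ->
  (0 < size s + size phis)%N -> in_letter_spans ks phis ->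
  Fil R m (sumn s + sumn ks) (size s + size phis)
    (ucoef (letters s (colors R al) ++ phis)).
Proof.
elim: ks phis s al => [|k ks IH] [|phi phis] //= s al sz s0 sgt.
  by rewrite !addn0 cats0 in sgt * => _; rewrite -mdf_ucoef //; apply: mdf_Fil.
case=> -[r [a [g [ha hg ->]]]] hks.
have -> : ucoef (letters s (colors R al) ++ \sum_(i < r) a i *: g i :: phis) =
   \sum_(i < r) a i *: ucoef (letters s (colors R al) ++ g i :: phis).
  apply/funext => n; rewrite qseries_lincombE /ucoef.
  set chi := (X in _ ++ X :: _).
  have -> : chi = fun v => \sum_(i < r) a i * g i v.
    by apply/funext => v; rewrite /chi qseries_lincombE.
  by rewrite usum_lincomb coef_sum; apply: eq_bigr => i _; rewrite coefZ.
apply: QN_span_sum => i _ _; apply: QN_spanZ => //.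
have [j [c [/andP[j0 jk] ->]]] := hg i.
rewrite -cat_rcons -letters_rcons //.
apply: (@Fil_le (sumn (rcons s j) + sumn ks) _ (size (rcons s j) + size phis)).
- by rewrite sumn_rcons; lia.
- by rewrite size_rcons addSnnS.
- apply: IH => //; rewrite ?size_rcons ?sz //.
  by rewrite all_rcons j0.
Qed.

(** The prefix [s0] collects the letters that the new letter has already passed in the
    quasi-shuffle. *)
Lemma stuffle_Fil s0 al0 s al : size al0 = size s0 -> size al = size s ->
  all (fun k => 0 < k)%N s0 -> all (fun k => 0 < k)%N s ->
  Fil R m (sumn s0 + sumn s + 2) (size s0 + size s + 1)
    (\sum_(x <- stuffle (letter 2 1) (letters s (colors R al)))
       ucoef (letters s0 (colors R al0) ++ x)).
Proof.
have span2 : @letter_span R m 2 (letter 2 1) by apply: (@letter_in_span R m 2 0).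
elim: s al s0 al0 => [|k s IH] [|c al] //= s0 al0 sz0.
  move=> _ p0 _; rewrite big_seq1 !addn0.
  have := @ucoef_Fil s0 al0 [:: 2%N] [:: letter 2 1] sz0 p0.
  by apply; rewrite /= ?addn1.
case=> sz p0 /andP[k0 ps]; rewrite !big_cons big_map.
rewrite -/(letters s (colors R al)); set L := letters s _; set lk := letter k _.
have sL : size L = size s by rewrite size_map size_zip size_map sz minnn.
apply: QN_spanD; last apply: QN_spanD.
- have hs : in_letter_spans [:: 2%N, k & s] [:: letter 2 1, lk & L].
    by split=> //; split; [apply: letter_in_span|apply: in_letter_spans_letters].
  apply: Fil_le (ucoef_Fil sz0 p0 _ hs); rewrite /= ?sL; lia.
(* The merged letter has weight at most k + 2, so the weight bound is kept and the depth is one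
   less. *)
- have hs : in_letter_spans (k.+2 :: s) (pos_conv (letter 2 1) lk :: L).
    by split; [apply: conv_in_span|apply: in_letter_spans_letters].
  apply: Fil_le (ucoef_Fil sz0 p0 _ hs); rewrite /= ?sL; lia.
- apply: (@Fil_le (sumn (rcons s0 k) + sumn s + 2) _ (size (rcons s0 k) + size s + 1)).
  + by rewrite sumn_rcons; lia.
  + by rewrite size_rcons; lia.
  + under eq_bigr do rewrite -cat_rcons -letters_rcons //.
    apply: IH => //; rewrite ?size_rcons ?sz0 //.
    by rewrite all_rcons k0.
Qed.

Lemma qmul_mdf2_Fil s al : (0 < size s)%N -> size al = size s ->
  all (fun k => 0 < k)%N s ->
  Fil R m (sumn s + 2) (size s + 1)
    (qmul (mdf R [:: 2%N] [:: 0 : 'I_m.+1]) (mdf R s al)).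
Proof.
move=> s0 sz ps; have := @stuffle_Fil [::] [::] s al erefl sz isT ps.
rewrite !mdf_ucoef //=; congr (Fil _ _ _ _ _); apply/funext => n.
rewrite qmul_ucoef fct_sumE /ucoef -coef_sum /letters /= expr0.
by rewrite -(@usum_stuffle _ n.+1 n.+1 (letter 2 1) _ n).
Qed.

(** * Weights and depths in the derivative formula *)

Lemma sumn_incr_nth s j : (j < size s)%N -> sumn (incr_nth s j) = (sumn s).+1.
Proof.
elim: s j => [|k s IH] [|j] //= js.
by rewrite IH // addnS.
Qed.

Lemma all_incr_nth s j : (j < size s)%N -> all (fun k => 0 < k)%N s ->
  all (fun k => 0 < k)%N (incr_nth s j).
Proof.
elim: s j => [|k s IH] [|j] //= js /andP[k0 s0]; first by rewrite s0.
by rewrite k0 IH.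
Qed.

Lemma sumn_split s j p q : (j < size s)%N ->
  (sumn (take j s ++ [:: p; q] ++ drop j.+1 s) + nth 0 s j = sumn s + (p + q))%N.
Proof.
move=> js; rewrite -{4}(cat_take_drop j s) (drop_nth 0%N js) !sumn_cat /=; lia.
Qed.

Lemma all_split s j p q : (0 < p)%N -> (0 < q)%N -> all (fun k => 0 < k)%N s ->
  all (fun k => 0 < k)%N (take j s ++ [:: p; q] ++ drop j.+1 s).
Proof.
move=> p0 q0; rewrite -{1}(cat_take_drop j s) !all_cat /= p0 q0.
case/andP=> -> /=; rewrite -[j.+1]add1n -drop_drop => h.
by apply/allP => x /mem_drop; apply/allP.
Qed.

Lemma split_Fil s al j p q k : (j < size s)%N -> size al = size s ->
  all (fun k => 0 < k)%N s -> (0 < p)%N -> (0 < q)%N ->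
  (sumn s + (p + q) <= nth 0 s j + k)%N ->
  Fil R m k (size s).+1
    (mdf R (take j s ++ [:: p; q] ++ drop j.+1 s) (take j.+1 al ++ drop j al)).
Proof.
move=> js sz ps p0 q0 hk; have ss := @size_split s j p q js.
apply: mdf_Fil; rewrite ?ss ?size_repeat ?sz //; first exact: all_split.
by have := @sumn_split s j p q js; lia.
Qed.

(** Term by term in the formula for the derivative: each word adds at most 2 to the weight and 1 to
    the depth, and the product with [2;0] is bounded by the quasi-shuffle. *)
Lemma qD_mdf_Fil s al : (0 < size s)%N -> size al = size s ->
  all (fun k => 0 < k)%N s ->
  Fil R m (sumn s).+2 (size s).+1 (qD (mdf R s al)).
Proof.
move=> s0 sz ps; rewrite (@qD_mdf _ _ (size s)) //.
have Qn n : QN R m.+1 n%:R by apply: QN_nat.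
have inc (j : 'I_(size s)) := sumn_incr_nth (ltn_ord j).
have sinc (j : 'I_(size s)) := size_incr_nth_lt (ltn_ord j).
have ainc (j : 'I_(size s)) := all_incr_nth (ltn_ord j) ps.
apply: QN_spanB; first apply: QN_spanB; first apply: QN_spanB;
  first apply: QN_spanB; first apply: QN_spanD.
- by rewrite -[(sumn s).+2]addn2 -[(size s).+1]addn1; apply: qmul_mdf2_Fil.
- apply: QN_span_sum => j _ _; apply: QN_spanZ => //.
  by apply: mdf_Fil; rewrite ?sinc ?inc.
- apply: QN_span_sum => j _ _; apply: QN_spanZ => //.
  by apply: mdf_Fil; rewrite ?size_rcons ?sumn_rcons ?all_rcons ?sinc ?inc ?sz ?addn1 ?ainc.
- by apply: mdf_Fil; rewrite ?size_rcons ?sumn_rcons ?all_rcons ?sz ?addn2.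
- apply: QN_span_sum => j _ _; apply: QN_span_sum_nat => a a1; apply: QN_spanZ => //.
  by apply: split_Fil => //; lia.
- apply: QN_span_sum => j _ _; apply: QN_span_sum => l _ lj.
  apply: QN_span_sum_nat => a a1; apply: QN_spanZ => //.
  (* As l < j, the word is a splitting of [incr_nth s l] at j, where the entry is still s_j. *)
  rewrite -(drop_incr_nth s lj).
  apply: (@Fil_le (sumn s).+2 _ (size (incr_nth s l)).+1) => //; first by rewrite sinc.
  apply: split_Fil; rewrite ?sinc ?inc ?ainc //; try lia.
  by rewrite nth_incr_nth eqn_leq [(j <= l)%N]leqNgt lj andbF add0n; lia.
Qed.

Lemma qD_lincomb r (c : 'I_r -> R[i]) (g : 'I_r -> nat -> R[i]) :
  qD (\sum_(i < r) c i *: g i) = \sum_(i < r) c i *: qD (g i).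
Proof.
apply/funext => n; rewrite /qD !fct_sumE mulr_sumr; apply: eq_bigr => i _.
exact: mulrCA.
Qed.

Lemma qD_Fil k d f : Fil R m k d f -> Fil R m k.+2 d.+1 (qD f).
Proof.
apply: QN_span_map => [r c g|{}f]; first exact: qD_lincomb.
move=> [s [al [[s0 sz ps ->] sk sd]]].
by apply: Fil_le (qD_mdf_Fil s0 sz ps); rewrite ltnS // ltnS.
Qed.

Lemma qD_MD f : MD R m f -> MD R m (qD f).
Proof.
apply: QN_span_map => [r c g|{}f]; first exact: qD_lincomb.
case=> [->|[s [al [s0 sz ps ->]]]].
  have -> : qD (qone R) = 0.
    by apply/funext => -[|n]; rewrite /qD /qone /= ?mul0r ?mulr0.
  exact: QN_span0.
apply: QN_span_sub (qD_mdf_Fil s0 sz ps) => {s al s0 sz ps}f0 [s [al [h _ _]]].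
by apply: QN_span_gen; right; exists s, al.
Qed.

(** Leibniz rule, from n = i + (n - i) in each term of the convolution. *)
Lemma qD_qmul (f g : nat -> R[i]) : qD (qmul f g) = qmul (qD f) g + qmul f (qD g).
Proof.
apply/funext => n; rewrite qseriesDE /qD /qmul mulr_sumr -big_split.
apply: eq_bigr => i _ /=; have i_n : (i <= n)%N by rewrite -ltnS.
by rewrite -{1}(subnKC i_n) natrD; ring.
Qed.

End FilClosure.

(* Indices j, l are 0-based, so that the factor d - j + 1 becomes d - j. *)
Theorem theorem7p8 (R : realType) (m : nat) :
  [/\ is_derivation_on (QN R m.+1) (MD R m) (@qD R),
      forall (d : nat) (s : d.-tuple nat) (al : d.-tuple 'I_m.+1),
        (2 <= d)%N -> (forall i, 0 < tnth s i)%N ->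
        qD (mdf R s al) =
          qmul (mdf R [:: 2%N] [:: 0 : 'I_m.+1]) (mdf R s al)
          + \sum_(j < d) ((d - j) * tnth s j)%N%:R *: mdf R (incr_nth s j) al
          - \sum_(j < d)
              (tnth s j)%:R *: mdf R (rcons (incr_nth s j) 1%N) (rcons al 0)
          - mdf R (rcons s 2%N) (rcons al 0)
          - \sum_(j < d) \sum_(1 <= a < (tnth s j + 2)%N)
              (a - 1)%N%:R *:
              mdf R (take j s ++ [:: a; (tnth s j + 2 - a)%N] ++ drop j.+1 s)
                    (take j.+1 al ++ drop j al)
          - \sum_(j < d) \sum_(l < d | (l < j)%N)
            \sum_(1 <= a < (tnth s j + 1)%N)
              (tnth s l)%:R *:
              mdf R (take j (incr_nth s l)
                       ++ [:: a; (tnth s j + 1 - a)%N] ++ drop j.+1 s)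
                    (take j.+1 al ++ drop j al) &
      forall (k d : nat) (f : nat -> R[i]),
        Fil R m k d f -> Fil R m k.+2 d.+1 (qD f)].
Proof.
split.
- split=> [f|c f g _ _ _|f g _ _]; [exact: qD_MD| |exact: qD_qmul].
  by apply/funext => n; rewrite /qD !qseriesDE mulrDr; congr (_ + _); apply: mulrCA.
- move=> d s al d2 s0; have t j : tnth s j = nth 0%N s j := tnth_nth 0%N s j.
  have ps : all (fun k => 0 < k)%N s by apply/all_tnthP.
  rewrite (@qD_mdf _ _ d) ?size_tuple ?(ltnW d2) //.
  congr (_ + _ - _ - _ - _ - _).
  + by apply: eq_bigr => j _; rewrite t.
  + by apply: eq_bigr => j _; rewrite t.
  + by apply: eq_bigr => j _; rewrite t.
  + apply: eq_bigr => j _; apply: eq_bigr => l _; rewrite t.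
    by apply: eq_bigr => a _; rewrite t.
- exact: qD_Fil.
Qed.
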